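(* Let $R>0$, let $E\subset\mathbb{R}^d$ be a body and let $a\in\partial\,co_R(E)\setminus E$. Then there exists an open ball $B$ of radius $R$ that $R$-supports $co_R(E)$ at $a$ (i.e. $a\in\partial B$, $B\cap co_R(E)=\emptyset$). Moreover, for such a ball $B$, assumed after translation to be centered at the origin $o$, with $S=\partial B$: (i) $\partial E\cap S$ contains at least two points; (ii) letting $F=\{\lambda x:\lambda\ge0,\ x\in\partial E\cap S\}$ and $C=co(F)$, if $C$ is pointed ($C\cap(-C)=\{o\}$), then there exist distinct points $x_1,\dots,x_s\in\partial E\cap S$, with $2\le s\le d$, such that $$a\in co^S_{sph}(\{x_1,\dots,x_s\}).$$
   Context: A body is a nonempty closed subset of $\mathbb{R}^d$; $co(\cdot)$ denotes convex hull. Fix $R>0$. The $R$-hulloid of a body $E$ is $co_R(E)=\bigcap\{\mathbb{R}^d\setminus B : B \text{ an open ball of radius } R,\ B\cap E=\emptyset\}$ (equal to $\mathbb{R}^d$ if no such ball exists). For a sphere $S$ centered at $o$ and $\mathcal K\subset S$, with $K=\{\lambda v:\lambda\ge0,\ v\in\mathcal K\}$, the spherical convex hull is $co^S_{sph}(\mathcal K)=co(K)\cap S$. *)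

(* Defs.v *)
From mathcomp Require Import all_boot all_order all_algebra reals.
Set Implicit Arguments. Unset Strict Implicit. Unset Printing Implicit Defensive.
Import Order.TTheory GRing.Theory Num.Theory.
Local Open Scope ring_scope.

Section Defs.
Variables (R : realType) (d : nat).
Notation vec := 'rV[R]_d.

Definition enorm (v : vec) : R := Num.sqrt (\sum_(i < d) v ord0 i ^+ 2).

Definition oball (c : vec) (r : R) (x : vec) : Prop := enorm (x - c) < r.
Definition sphere (c : vec) (r : R) (x : vec) : Prop := enorm (x - c) = r.

Definition is_closed (A : vec -> Prop) : Prop :=
  forall x, (forall eps : R, 0 < eps -> exists y, A y /\ enorm (y - x) < eps) -> A x.
Definition boundary (A : vec -> Prop) (x : vec) : Prop :=
  forall eps : R, 0 < eps ->
    (exists y, A y /\ enorm (y - x) < eps) /\ (exists y, ~ A y /\ enorm (y - x) < eps).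

Definition body (E : vec -> Prop) : Prop := (exists x, E x) /\ is_closed E.

Definition conv (A : vec -> Prop) (x : vec) : Prop :=
  exists (n : nat) (p : 'I_n -> vec) (w : 'I_n -> R),
    (forall i, A (p i)) /\ (forall i, 0 <= w i) /\ \sum_(i < n) w i = 1 /\
    x = \sum_(i < n) w i *: p i.

(* R-hulloid: intersection of complements of open balls of radius r missing E
   (equal to the whole space if there is no such ball) *)
Definition hulloid (r : R) (E : vec -> Prop) (x : vec) : Prop :=
  forall c : vec, (forall y, E y -> ~ oball c r y) -> ~ oball c r x.

Definition supports (r : R) (c : vec) (A : vec -> Prop) (a : vec) : Prop :=
  sphere c r a /\ (forall y, A y -> ~ oball c r y).

Definition cone0 (K : vec -> Prop) (y : vec) : Prop :=
  exists (l : R) (v : vec), 0 <= l /\ K v /\ y = l *: v.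

Definition sph_hull (r : R) (K : vec -> Prop) (y : vec) : Prop :=
  conv (cone0 K) y /\ sphere 0 r y.

Definition pointed (C : vec -> Prop) : Prop :=
  (forall v, C v -> C (- v) -> v = 0) /\ C 0.

Definition translate (c : vec) (A : vec -> Prop) (y : vec) : Prop := A (y + c).

End Defs.

(* Main.v *)
(** A limit of radius-r balls that miss E and approach a supports the hulloid at a.
Center such a ball at the origin, and let K be the set of points of E on its boundary
sphere.  If some u had negative inner product with all of K and positive inner product
with a, then the ball shifted by a small multiple of u would still miss E and would
contain a, contradicting that a lies in the hulloid.  If K had at most one point x, then
u = a - x (or u = a) would be such a direction.  Otherwise Gordan's alternative, applied
to the compact set K together with -a, gives a vanishing convex combination of these
points; pointedness forces the coefficient of -a to be positive, so a lies in the cone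
spanned by K, and Carathéodory's theorem for cones leaves at most d linearly independent
points. *)

From mathcomp Require Import all_boot all_order all_algebra.
From mathcomp Require Import boolp classical_sets reals topology normedtype derive.
From mathcomp Require Import ring lra.
Require Import Defs.
Import Order.TTheory GRing.Theory Num.Theory numFieldNormedType.Exports.
Local Open Scope ring_scope.
Set Implicit Arguments. Unset Strict Implicit. Unset Printing Implicit Defensive.


(** * Linear independence of finite families and Carathéodory's theorem for cones *)

Section Independence.
Variables (F : fieldType) (m : nat) (I : finType) (p : I -> 'rV[F]_m).

Definition independent_on (Q : {set I}) :=
  forall u : I -> F, \sum_(i in Q) u i *: p i = 0 -> forall i, i \in Q -> u i = 0.

(** Independence is that of the indexed family, so a repeated vector [p i = p j] would give the
    nontrivial relation with coefficients 1 at [i] and -1 at [j]. *)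
Lemma independent_on_inj Q : independent_on Q -> {in Q &, injective p}.
Proof.
move=> indQ i j iQ jQ pij; apply/eqP/negPn/negP => nij.
pose u k : F := (k == i)%:R - (k == j)%:R.
have : u i = 0.
  apply: indQ => //; rewrite (bigD1 i)//= (bigD1 j) 1?eq_sym ?nij ?jQ//=.
  rewrite big1 => [|k /andP[/andP[_ /negPf ki] /negPf kj]].
    by rewrite /u !eqxx (eq_sym j) (negPf nij) pij subr0 sub0r scale1r scaleN1r addr0 subrr.
  by rewrite /u ki kj subrr scale0r.
by rewrite /u eqxx (negPf nij) subr0 => /eqP; rewrite oner_eq0.
Qed.

Lemma independent_on_card Q : independent_on Q -> (#|Q| <= m)%N.
Proof.
move=> indQ; pose A := \matrix_(k < #|Q|) p (enum_val k).
suff /eqP <- : row_free A by exact: rank_leq_col.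
apply: inj_row_free => v vA; apply/rowP => k; rewrite mxE.
(* The row coefficients are carried over to [I]; since [enum_val] is injective, the sum has one term
   on [Q] and is empty elsewhere. *)
pose u i := \sum_(l < #|Q| | enum_val l == i) v ord0 l.
have uE l : u (enum_val l) = v ord0 l.
  by rewrite /u (big_pred1 l)// => j; rewrite /= (inj_eq enum_val_inj).
rewrite -uE; apply: indQ; last exact: enum_valP.
rewrite big_enum_val -[RHS]vA mulmx_sum_row; apply: eq_bigr => l _.
by rewrite uE rowK.
Qed.

End Independence.

(** Induction on the size of [Q]. From a linear relation [u] with a positive coefficient, the
    multiple [t * u] is subtracted from [w], where [t] is the least ratio [w j / u j] over positive
    [u j]: all weights stay nonnegative, the sum is unchanged and the minimizing index drops out. *)
Lemma conic_caratheodory (R : realFieldType) (m : nat) (I : finType)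
    (p : I -> 'rV[R]_m) (Q : {set I}) (w : I -> R) :
  (forall i, 0 <= w i) ->
  exists (Q' : {set I}) (w' : I -> R), [/\ Q' \subset Q, independent_on p Q',
    forall i, 0 <= w' i & \sum_(i in Q) w i *: p i = \sum_(i in Q') w' i *: p i].
Proof.
have [n] := ubnP #|Q|; elim: n => // n IHn in Q w * => ltQn w0.
have [indQ|] := pselect (independent_on p Q); first by exists Q, w; split.
move=> /existsNP[u /not_implyP[uQ /existsNP[i /not_implyP[iQ /eqP ui]]]].
wlog {ui} ui : u uQ / 0 < u i.
  move=> ih; have /orP[|ui0] := lt_total ui; last exact: (ih u).
  move=> ui0; apply: (ih (fun j => - u j)); last by rewrite oppr_gt0.
  under eq_bigr do rewrite scaleNr.
  by rewrite sumrN uQ oppr0.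
pose P := [pred j | (j \in Q) && (0 < u j)].
have Pi : P i by rewrite /= iQ.
case: (@Order.TotalTheory.arg_minP _ _ _ i P (fun j => w j / u j) Pi) => j /andP[jQ uj] jmin.
pose t := w j / u j.
have t0 : 0 <= t by rewrite divr_ge0 // ltW.
(* The default 0 outside [Q] makes the weights nonnegative on all of [I], as the induction
   hypothesis requires. *)
pose w' k := if k \in Q then w k - t * u k else 0.
have w'0 k : 0 <= w' k.
  rewrite /w'; case: ifPn => // kQ; rewrite subr_ge0.
  have [uk|uk] := ltP 0 (u k).
    by rewrite -ler_pdivlMr// jmin//= kQ.
  by rewrite (le_trans _ (w0 k))// mulr_ge0_le0.
have w'j : w' j = 0 by rewrite /w' jQ /t divfK ?subrr// gt_eqF.
have [||Q' [v [sQ' indQ' v0 vE]]] := IHn (Q :\ j) w' => //.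
  by rewrite (cardsD1 j) jQ in ltQn.
exists Q', v; split => //; first by rewrite (fintype.subset_trans sQ')// finset.subsetDl.
rewrite -vE [RHS](_ : _ = \sum_(k in Q) w' k *: p k); last first.
  by rewrite [RHS](big_setD1 j)//= w'j scale0r add0r.
rewrite [RHS](_ : _ = \sum_(k in Q) w k *: p k - t *: \sum_(k in Q) u k *: p k); last first.
  rewrite scaler_sumr -sumrB; apply: eq_bigr => k kQ.
  by rewrite /w' kQ scalerBl scalerA.
by rewrite uQ scaler0 subr0.
Qed.


(** * Euclidean geometry, and its link to the topology of row vectors *)

Section Euclid.
Variables (R : realType) (d : nat).
Implicit Types (u v x y z : 'rV[R]_d) (t : R).

Definition dot u v : R := \sum_(i < d) u ord0 i * v ord0 i.

Lemma dotC u v : dot u v = dot v u.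
Proof. by apply: eq_bigr => i _; rewrite mulrC. Qed.

Lemma dotDl u v x : dot (u + v) x = dot u x + dot v x.
Proof. by rewrite -big_split; apply: eq_bigr => i _; rewrite mxE mulrDl. Qed.

Lemma dotDr u v x : dot x (u + v) = dot x u + dot x v.
Proof. by rewrite !(dotC x) dotDl. Qed.

Lemma dotZl t u x : dot (t *: u) x = t * dot u x.
Proof. by rewrite mulr_sumr; apply: eq_bigr => i _; rewrite mxE mulrA. Qed.

Lemma dotZr t u x : dot x (t *: u) = t * dot x u.
Proof. by rewrite !(dotC x) dotZl. Qed.

Lemma dotNl u x : dot (- u) x = - dot u x.
Proof. by rewrite -scaleN1r dotZl mulN1r. Qed.

Lemma dotNr u x : dot x (- u) = - dot x u.
Proof. by rewrite !(dotC x) dotNl. Qed.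

Definition dotE := (dotDl, dotDr, dotNl, dotNr, dotZl, dotZr).

Lemma dot_ge0 v : 0 <= dot v v.
Proof. by apply: sumr_ge0 => i _; rewrite -expr2 sqr_ge0. Qed.

Lemma enormE v : enorm v = Num.sqrt (dot v v).
Proof. by []. Qed.

Lemma enorm_sqr v : enorm v ^+ 2 = dot v v.
Proof. by rewrite enormE sqr_sqrtr// dot_ge0. Qed.

Lemma enorm_ge0 v : 0 <= enorm v.
Proof. exact: sqrtr_ge0. Qed.

Lemma enorm_lt v t : 0 <= t -> (enorm v < t) = (dot v v < t ^+ 2).
Proof. by move=> t0; rewrite -enorm_sqr ltr_pXn2r// nnegrE enorm_ge0. Qed.

Lemma enorm_le v t : 0 <= t -> (enorm v <= t) = (dot v v <= t ^+ 2).
Proof. by move=> t0; rewrite -enorm_sqr ler_pXn2r// nnegrE enorm_ge0. Qed.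

Lemma enormN v : enorm (- v) = enorm v.
Proof. by rewrite !enormE !dotE opprK. Qed.

Lemma enormB u v : enorm (u - v) = enorm (v - u).
Proof. by rewrite -enormN opprB. Qed.

Lemma enormZ t v : enorm (t *: v) = `|t| * enorm v.
Proof. by rewrite !enormE !dotE mulrA -expr2 sqrtrM ?sqr_ge0// sqrtr_sqr. Qed.

Lemma coord_le_enorm v i : `|v ord0 i| <= enorm v.
Proof.
rewrite -sqrtr_sqr enormE ler_wsqrtr// /dot (bigD1 i)//= -expr2 lerDl.
by apply: sumr_ge0 => j _; rewrite -expr2 sqr_ge0.
Qed.

Lemma dot_eq0 v : dot v v = 0 -> v = 0.
Proof.
move=> v0; apply/rowP => i; rewrite mxE; apply/eqP; rewrite -normr_le0.
by rewrite (le_trans (coord_le_enorm v i))// enormE v0 sqrtr0.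
Qed.

Lemma enorm0 : enorm (0 : 'rV[R]_d) = 0.
Proof. by rewrite -(scale0r 0) enormZ normr0 mul0r. Qed.

(** Cauchy-Schwarz, from the nonnegative square of [dot v v *: u - dot u v *: v]. *)
Lemma dot_le_enorm u v : dot u v <= enorm u * enorm v.
Proof.
have [/eqP v0|v0] := boolP (dot v v == 0).
  by rewrite (dot_eq0 v0) enorm0 mulr0 -(scale0r 0) dotZr mul0r.
have vp : 0 < dot v v by rewrite lt_neqAle eq_sym v0 dot_ge0.
have := dot_ge0 (dot v v *: u - dot u v *: v).
rewrite !dotE (dotC v u) => h.
have : 0 <= dot v v * (dot u u * dot v v - dot u v ^+ 2) by lra.
rewrite pmulr_rge0// subr_ge0 => h2.
rewrite (le_trans (ler_norm _))// -sqrtr_sqr -sqrtrM ?dot_ge0//.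
exact: ler_wsqrtr.
Qed.

Lemma enormD u v : enorm (u + v) <= enorm u + enorm v.
Proof.
rewrite enorm_le ?addr_ge0 ?enorm_ge0// !dotE (dotC v u) sqrrD !enorm_sqr.
by have := dot_le_enorm u v; lra.
Qed.

Lemma enorm_dist_triangle z x y : enorm (x - y) <= enorm (x - z) + enorm (z - y).
Proof. by rewrite (le_trans _ (enormD _ _))// addrA subrK. Qed.

(** Here [|v|] is the sup norm, so Euclidean boundedness gives boundedness in the sense of the
    compactness theorem. *)
Lemma norm_le_enorm v : `|v| <= enorm v.
Proof.
rewrite /Num.norm/= mx_normrE; apply/bigmax_leP; split; first exact: enorm_ge0.
by move=> [i j] _ /=; rewrite ord1 coord_le_enorm.
Qed.

Local Open Scope classical_set_scope.

Lemma continuous_sqdist x : continuous (fun y => dot (y - x) (y - x)).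
Proof.
rewrite /dot; apply: continuous_big => [|i _ y].
  exact: add_continuous.
have h : {for y, continuous (fun z => (z - x) ord0 i : R)}.
  rewrite (_ : (fun z => _) = (fun z => z ord0 i - x ord0 i)); last first.
    by apply/funext => z; rewrite !mxE.
  apply: (@cvgB _ _ _ (nbhs y) _ (fun z : 'rV[R]_d => z ord0 i) (fun=> x ord0 i)).
    exact: (@coord_continuous R 1 d ord0 i y).
  exact: cvg_cst.
apply: (@cvgM _ _ (nbhs y) _ (fun z => (z - x) ord0 i) (fun z => (z - x) ord0 i)); exact: h.
Qed.

Lemma enorm_ball_nbhs x e : 0 < e -> nbhs x [set y | enorm (y - x) < e].
Proof.
move=> e0; have := @continuous_sqdist x x.
move=> /(_ [set z | z < e ^+ 2]) /=.
rewrite subrr -(scale0r 0) dotZl mul0r => h.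
have : nbhs x [set y | dot (y - x) (y - x) < e ^+ 2].
  apply: h; exact: lt_nbhsl (exprn_gt0 _ e0).
by apply: filterS => y /=; rewrite enorm_lt// ltW.
Qed.

Lemma is_closed_closed (A : set 'rV[R]_d) : is_closed A -> closed A.
Proof.
move=> cA x Ax; apply: cA => e e0.
by have [y [Ay xy]] := Ax _ (enorm_ball_nbhs x e0); exists y.
Qed.

Lemma closed_bounded_compact (A : set 'rV[R]_d) M :
  is_closed A -> (forall x, A x -> enorm x <= M) -> compact A.
Proof.
move=> cA bA; apply: bounded_closed_compact; last exact: is_closed_closed.
exists M; split; first exact: num_real.
move=> N MN x /bA xM; exact: le_trans (le_trans (norm_le_enorm x) xM) (ltW MN).
Qed.

Lemma compact_closest_point (A : set 'rV[R]_d) x : compact A -> A !=set0 ->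
  exists2 y, A y & forall z, A z -> enorm (y - x) <= enorm (z - x).
Proof.
move=> cA A0.
have [|y Ay ymin] := EVT_min_rV A0 cA (f := fun y => dot (y - x) (y - x)).
  by apply: continuous_subspaceT; exact: continuous_sqdist.
exists y; first by rewrite inE in Ay.
by move=> z Az; rewrite !enormE ler_wsqrtr// ymin// inE.
Qed.

(** Only the points of [A] no farther from [x] than some chosen [a] compete, and these form a
    compact set. *)
Lemma closed_closest_point (A : set 'rV[R]_d) x : is_closed A -> A !=set0 ->
  exists2 y, A y & forall z, A z -> enorm (y - x) <= enorm (z - x).
Proof.
move=> cA [a Aa]; pose r := enorm (a - x).
have cB : compact [set y | A y /\ enorm (y - x) <= r].
  apply: (@closed_bounded_compact _ (r + enorm x)) => [y yB|y [_ yr]]; last first.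
    by rewrite -{1}(subrK x y) (le_trans (enormD _ _))// lerD2r.
  split.
    by apply: cA => e /yB[z [[Az _] zy]]; exists z.
  apply/ler_addgt0Pr => e /yB[z [[_ zr] zy]].
  rewrite (le_trans (enorm_dist_triangle z _ _))// addrC lerD// ltW//.
  by rewrite enormB.
have [|y [Ay yr] ymin] := compact_closest_point x cB; first by exists a.
exists y => // z Az; have [zr|/ltW rz] := leP (enorm (z - x)) r; first exact: ymin.
exact: le_trans rz.
Qed.

End Euclid.


(** * Compactness of convex hulls and Gordan's alternative *)

Section ConvexHull.
Variables (R : realType) (d : nat).
Implicit Types (A K : 'rV[R]_d -> Prop) (x y u : 'rV[R]_d) (t : R).

Local Open Scope classical_set_scope.

(** Sums of [n] points of [K] with weights in [0, 1], paired with the total weight. The recursion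
    displays this set as an iterated continuous image of products, hence compact; recording the
    total lets the condition that it equals 1 be imposed afterwards as a closed one. *)
Fixpoint weighted_sums K n : set (R * 'rV[R]_d) :=
  if n is m.+1 then
    [set (z.1.1 + z.2.1, z.1.1 *: z.1.2 + z.2.2)
      | z in (`[0, 1] `*` K) `*` weighted_sums K m]
  else [set (0, 0)].

Lemma weighted_sums_compact K n : compact K -> compact (weighted_sums K n).
Proof.
move=> cK; elim: n => [|n IHn]; first exact: compact_set1.
apply: continuous_compact; last first.
  by apply: compact_setX => //; apply: compact_setX => //; exact: segment_compact.
apply: continuous_subspaceT => z.
have c1 : z'.1 @[z' --> z] --> z.1 by exact: cvg_fst.
have c2 : z'.2 @[z' --> z] --> z.2 by exact: cvg_snd.
have c11 : z'.1.1 @[z' --> z] --> z.1.1 by apply: cvg_comp c1 _; exact: cvg_fst.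
have c12 : z'.1.2 @[z' --> z] --> z.1.2 by apply: cvg_comp c1 _; exact: cvg_snd.
have c21 : z'.2.1 @[z' --> z] --> z.2.1 by apply: cvg_comp c2 _; exact: cvg_fst.
have c22 : z'.2.2 @[z' --> z] --> z.2.2 by apply: cvg_comp c2 _; exact: cvg_snd.
apply: (@cvg_pair _ _ _ (nbhs z) (nbhs (z.1.1 + z.2.1))
  (nbhs (z.1.1 *: z.1.2 + z.2.2)) _ _ _ (fun z' => z'.1.1 + z'.2.1)
  (fun z' => z'.1.1 *: z'.1.2 + z'.2.2)).
  exact: cvgD c11 c21.
exact: cvgD (cvgZ c11 c12) c22.
Qed.

Lemma mem_weighted_sums K (I : finType) (Q : {set I}) (p : I -> 'rV[R]_d)
    (w : I -> R) n :
  K !=set0 -> (forall i, i \in Q -> K (p i)) ->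
  (forall i, i \in Q -> 0 <= w i <= 1) -> (#|Q| <= n)%N ->
  weighted_sums K n (\sum_(i in Q) w i, \sum_(i in Q) w i *: p i).
Proof.
move=> [x0 Kx0]; elim: n Q => [|n IHn] Q Kp w01 cQ.
  move: cQ; rewrite leqn0 cards_eq0 => /eqP ->.
  by rewrite !big_set0.
have [->|[i iQ]] := set_0Vmem Q.
  (* Once [Q] is exhausted, the remaining slots are padded with [x0] at weight 0. *)
  exists ((0, x0), (0, 0)); last by rewrite /= !big_set0 scale0r !addr0.
  split => /=; first by split => //=; rewrite in_itv /= lexx ler01.
  have := IHn finset.set0; rewrite !big_set0; apply; rewrite ?cards0// => i.
    by rewrite finset.in_set0.
  by rewrite finset.in_set0.
rewrite (big_setD1 i)//= [X in (_, X)](big_setD1 i)//=.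
exists ((w i, p i), (\sum_(j in Q :\ i) w j, \sum_(j in Q :\ i) w j *: p j)) => //.
split; first by split => /=; [rewrite in_itv /= w01 | exact: Kp].
apply: IHn => [j|j|]; last by rewrite (cardsD1 i) iQ in cQ.
  by move=> /setD1P[_]; exact: Kp.
by move=> /setD1P[_]; exact: w01.
Qed.

Lemma weighted_sumsP K n z : weighted_sums K n z ->
  exists (p : 'I_n -> 'rV[R]_d) (w : 'I_n -> R), [/\ forall i, K (p i),
    forall i, 0 <= w i, \sum_(i < n) w i = z.1 & \sum_(i < n) w i *: p i = z.2].
Proof.
elim: n z => [_ ->|n IHn _ [[[t x] z] [[/= t01 Kx] /IHn[p [w [Kp w0 sw sp]]]] <-]].
  by exists (fun=> 0), (fun=> 0); split; rewrite ?big_ord0 //; by case.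
exists (fun i => oapp p x (unlift ord0 i)), (fun i => oapp w t (unlift ord0 i)).
split => [i|i||].
- by case: unliftP => [j _|_] /=.
- case: unliftP => [j _|_]//=; by move: t01; rewrite in_itv => /andP[].
- by rewrite big_ord_recl unlift_none; under eq_bigr do rewrite liftK; rewrite /= sw.
- by rewrite big_ord_recl unlift_none; under eq_bigr do rewrite liftK; rewrite /= sp.
Qed.

(* Carathéodory: d + 1 points suffice, since the lifted points (1, x) live in dimension 1 + d *)
Lemma convE K : conv K = snd @` (weighted_sums K d.+1 `&` fst @^-1` [set 1]).
Proof.
apply/seteqP; split => y; last first.
  move=> [[s z] [/weighted_sumsP[p [w [Kp w0 sw sp]]] /= s1] <-].
  by exists d.+1, p, w; rewrite sw sp.
move=> [n [p [w [Kp [w0 [sw ->]]]]]].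
have K0 : K !=set0.
  case: (n) p Kp w w0 sw => [p _ w _|m p Kp' _ _ _]; last by exists (p ord0).
  by rewrite big_ord0 => /eqP; rewrite eq_sym oner_eq0.
pose q i : 'rV[R]_(1 + d) := row_mx 1 (p i).
have [Q [w' [_ /independent_on_card cQ w'0]]] := @conic_caratheodory _ _ _ q finset.setT w w0.
under eq_bigl do rewrite finset.in_setT.
have lift1 v (P : pred 'I_n) : lsubmx (\sum_(i | P i) v i *: q i) 0 0 = \sum_(i | P i) v i.
  rewrite linear_sum summxE; apply: eq_bigr => i _.
  by rewrite linearZ /= row_mxKl !mxE mulr1.
have lift2 v (P : pred 'I_n) : rsubmx (\sum_(i | P i) v i *: q i) = \sum_(i | P i) v i *: p i.
  by rewrite linear_sum; apply: eq_bigr => i _; rewrite linearZ /= row_mxKr.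
move=> eq; have := congr1 rsubmx eq; rewrite !lift2 => ->.
have := congr1 (fun v => lsubmx v 0 0) eq; rewrite /= !lift1 sw => sw'.
have := @mem_weighted_sums K _ Q p w' d.+1.
set z := (_, _) => mem_z.
exists z; last by []; split; last by [].
apply: mem_z => [//|i _|i iQ|]; [exact: Kp| |exact: cQ].
rewrite w'0 sw' (bigD1 i)//= lerDl.
by apply: sumr_ge0.
Qed.

Lemma compact_conv K : compact K -> compact (conv K).
Proof.
move=> cK; rewrite convE; apply: continuous_compact.
  by apply: continuous_subspaceT => z; exact: cvg_snd.
apply: compact_closedI; first exact: weighted_sums_compact.
apply: closed_comp; last exact: closed_eq.
by move=> z _; exact: cvg_fst.
Qed.

Lemma conv_subset A x : A x -> conv A x.
Proof.
move=> Ax; exists 1, (fun=> x), (fun=> 1); split => //; split => //.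
by rewrite !big_ord1 scale1r.
Qed.

Lemma conv_segment A x y t : 0 <= t <= 1 -> conv A y -> A x ->
  conv A ((1 - t) *: y + t *: x).
Proof.
move=> /andP[t0 t1] [n [p [w [Ap [w0 [sw ->]]]]]] Ax.
exists n.+1, (fun i => oapp p x (unlift ord0 i)),
  (fun i => oapp (fun j => (1 - t) * w j) t (unlift ord0 i)).
split; [|split; [|split]].
- by move=> i; case: unliftP => [j _|_] /=.
- move=> i; case: unliftP => [j _|_]//=; by rewrite mulr_ge0// subr_ge0.
- rewrite big_ord_recl unlift_none; under eq_bigr do rewrite liftK.
  by rewrite /= -mulr_sumr sw mulr1 addrC subrK.
- rewrite big_ord_recl unlift_none; under [in RHS]eq_bigr do rewrite liftK.
  rewrite /= addrC scaler_sumr; congr (_ + _); apply: eq_bigr => i _.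
  by rewrite scalerA.
Qed.

(** If [y] is the point of the compact hull closest to 0, then [- y] works: a point [x] of [K] with
    [dot y x <= 0] would let the segment from [y] to [x] come closer to 0. *)
Lemma compact_gordan K : compact K -> ~ conv K 0 ->
  exists u, forall x, K x -> dot u x < 0.
Proof.
move=> cK nK; have [[x0 Kx0]|K0] := pselect (K !=set0); last first.
  by exists 0 => x Kx; case: K0; exists x.
have [|y Ky ymin] := compact_closest_point 0 (compact_conv cK).
  by exists x0; exact: conv_subset.
have N0 : 0 < dot y y.
  by rewrite lt_neqAle dot_ge0 andbT eq_sym; apply/eqP => /dot_eq0 y0; rewrite y0 in Ky.
exists (- y) => x Kx; rewrite dotNl oppr_lt0.
have D0 := dot_ge0 (x - y).
set N := dot y y in N0 *; set D := dot (x - y) (x - y) in D0 *.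
have ND : 0 < N + D by lra.
(* Minimality of [y] at parameter [t] gives [0 <= 2 * (dot y x - N) + t * D]. This [t] lies in (0,
   1] and satisfies [t * D <= N], so [2 * dot y x >= N > 0] with no passage to the limit. *)
pose t := N / (N + D).
have t0 : 0 < t by rewrite divr_gt0.
have t1 : t <= 1 by rewrite ler_pdivrMr// mul1r; lra.
have tN : t * (N + D) = N by rewrite divfK ?gt_eqF.
have := ymin _ (conv_segment (x := x) (t := t) _ Ky Kx).
rewrite (ltW t0) t1 !subr0 => /(_ isT).
rewrite enorm_le ?enorm_ge0// enorm_sqr -/N => h.
have {}h : N <= N + t * (2 * (dot y x - N) + t * D).
  apply: le_trans h _; rewrite le_eqVlt; apply/orP; left; apply/eqP.
  by rewrite /N /D !dotE (dotC x y); ring.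
have : 0 <= t * (2 * (dot y x - N) + t * D) by lra.
rewrite pmulr_rge0// => h2.
have : t * D <= N by rewrite -tN mulrDr lerDr mulr_ge0// ltW.
lra.
Qed.

End ConvexHull.


(** * Conic combinations and pointed cones *)

Section Cones.
Variables (R : realType) (d : nat).
Implicit Types (K : 'rV[R]_d -> Prop) (x y u : 'rV[R]_d) (t : R).

(** A conic sum is the average of its terms scaled by [#|Q|], and cones absorb scaling; [Q] is
    nonempty because no convex combination is empty. *)
Lemma cone0_conv_sum K (I : finType) (Q : {set I}) (p : I -> 'rV[R]_d)
    (w : I -> R) : Q != finset.set0 -> (forall i, i \in Q -> K (p i)) ->
  (forall i, i \in Q -> 0 <= w i) ->
  conv (cone0 K) (\sum_(i in Q) w i *: p i).
Proof.
rewrite -card_gt0 => Q0 Kp w0.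
have n0 : #|Q|%:R != 0 :> R by rewrite pnatr_eq0 -lt0n.
exists #|Q|, (fun k => (#|Q|%:R * w (enum_val k)) *: p (enum_val k)), (fun=> #|Q|%:R^-1).
split; [|split; [|split]].
- move=> k; exists (#|Q|%:R * w (enum_val k)), (p (enum_val k)).
  by rewrite mulr_ge0// ?w0 ?enum_valP//; split => //; split => //; apply/Kp/enum_valP.
- by move=> _; rewrite invr_ge0.
- by rewrite sumr_const card_ord -[LHS]mulr_natl mulfV.
- rewrite big_enum_val; apply: eq_bigr => k _.
  by rewrite scalerA mulrA mulVf ?mul1r.
Qed.

(** Each term lies in the cone, and so does its opposite, being the sum of the other terms.
    Pointedness makes the term vanish, and [p i] is nonzero. *)
Lemma pointed_cone0_sum_eq0 K (I : finType) (Q : {set I}) (p : I -> 'rV[R]_d)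
    (w : I -> R) : pointed (conv (cone0 K)) -> ~ K 0 ->
  (forall i, i \in Q -> K (p i)) -> (forall i, i \in Q -> 0 <= w i) ->
  \sum_(i in Q) w i *: p i = 0 -> forall i, i \in Q -> w i = 0.
Proof.
move=> [ptd _] K0 Kp w0 sum0 i iQ.
suff /eqP : w i *: p i = 0.
  by rewrite scaler_eq0 => /orP[/eqP//|/eqP pi0]; have := Kp _ iQ; rewrite pi0.
have eN : - (w i *: p i) = \sum_(j in Q :\ i) w j *: p j.
  by apply/eqP; rewrite eq_sym -addr_eq0 addrC -(big_setD1 i (A := Q))//= sum0.
have [Q0|Q0] := eqVneq (Q :\ i) finset.set0.
  by apply/eqP; rewrite -oppr_eq0 eN Q0 big_set0.
apply: ptd.
  by apply: conv_subset; exists (w i), (p i); rewrite w0 //; split => //; split => //; exact: Kp.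
by rewrite eN; apply: cone0_conv_sum => // j /setD1P[_ jQ]; [exact: Kp|exact: w0].
Qed.

End Cones.

(** * The hulloid, its supporting balls and the shifted-ball argument *)

Section Hulloid.
Variables (R : realType) (d : nat) (r : R).
Implicit Types (E : 'rV[R]_d -> Prop) (a c x y u : 'rV[R]_d).

Lemma sub_hulloid E x : E x -> hulloid r E x.
Proof. by move=> Ex c; exact. Qed.

Lemma hulloid_translate E c x : hulloid r E x -> hulloid r (translate c E) (x - c).
Proof.
have e b y : y - c - b = y - (b + c) by rewrite opprD addrA addrAC.
move=> hx b hb; rewrite /oball e; apply: hx => y Ey.
by rewrite /oball -e; apply: hb; rewrite /translate subrK.
Qed.

Lemma translate_closed E c : is_closed E -> is_closed (translate c E).
Proof.
move=> cE x hx; apply: cE => e /hx[y [Ey yx]]; exists (y + c).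
by rewrite opprD addrACA subrr addr0.
Qed.

Lemma boundary_closed E x : is_closed E -> boundary E x -> E x.
Proof. by move=> cE bE; apply: cE => e /bE[]. Qed.

(** The hulloid is closed: an open ball containing [a] also contains the points near [a]. *)
Lemma boundary_hulloid E a : boundary (hulloid r E) a -> hulloid r E a.
Proof.
move=> bE c hc ac; have [|[y [/(_ c hc) hy ya]] _] := bE (r - enorm (a - c)).
  by rewrite subr_gt0.
apply: hy; rewrite /oball (le_lt_trans (enorm_dist_triangle a _ _))//.
by rewrite -ltrBrDr.
Qed.

Lemma missing_centers_closed E :
  is_closed (fun c => forall y, E y -> ~ oball c r y).
Proof.
move=> c hc y Ey yc; have [|b [hb bc]] := hc (r - enorm (y - c)).
  by rewrite subr_gt0.
apply: (hb _ Ey); rewrite /oball (le_lt_trans (enorm_dist_triangle c _ _))//.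
by rewrite (enormB c) addrC -ltrBrDr.
Qed.

(** The center is a closest point to [a] in the closed set of centers of balls missing [E]. Points
    outside the hulloid close to [a] lie in such balls, so the distance is at most [r]; it is at
    least [r] because [a] is in the hulloid. *)
Lemma exists_supports E a : boundary (hulloid r E) a ->
  exists c, supports r c (hulloid r E) a.
Proof.
move=> bE.
pose D c := forall y, E y -> ~ oball c r y.
have near_center e : 0 < e -> exists2 c, D c & enorm (c - a) < r + e.
  move=> /bE[_ [y [hy ya]]].
  move/existsNP: hy => [c /not_implyP[Dc /contrapT yc]]; exists c => //.
  rewrite (le_lt_trans (enorm_dist_triangle y _ _))//.
  by rewrite ltrD// enormB.
have [c Dc cmin] : exists2 c, D c & forall z, D z -> enorm (c - a) <= enorm (z - a).
  apply: closed_closest_point; first exact: missing_centers_closed.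
  by have [c Dc _] := near_center 1 ltr01; exists c.
exists c; split; last by move=> y hy; exact: hy.
apply/eqP; rewrite eq_le; apply/andP; split.
  rewrite enormB; apply/ler_addgt0Pr => e /near_center[b Db ba].
  exact: le_trans (cmin _ Db) (ltW ba).
by rewrite leNgt; apply/negP; exact: (boundary_hulloid bE Dc).
Qed.

Lemma boundary_of_sphere E x : 0 < r -> (forall y, E y -> r <= enorm y) ->
  E x -> enorm x = r -> boundary E x.
Proof.
move=> r0 Er Ex xr e e0; split; first by exists x; rewrite subrr enorm0.
(* Shrinking [x] by the factor [1 - t] enters the open ball, hence leaves [E], and moves [x] by
   [t * r], at most [e / 2]. *)
pose t := Num.min 1 (e / (2 * r)).
have t0 : 0 < t by rewrite lt_min ltr01 divr_gt0// mulr_gt0.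
have t1 : t <= 1 by rewrite ge_min lexx.
have te : t * r < e.
  rewrite -ltr_pdivlMr// gt_min; apply/orP; right.
  by rewrite invfM mulrA ltr_pM2r ?invr_gt0// ltr_pdivrMr//; lra.
exists ((1 - t) *: x); split.
  move=> /Er; rewrite enormZ ger0_norm ?subr_ge0// xr; apply/negP.
  by rewrite -ltNge mulrBl mul1r gtrBl mulr_gt0.
by rewrite scalerBl scale1r addrC addKr enormN enormZ xr gtr0_norm.
Qed.

Lemma halfspace_closed u : is_closed (fun x => 0 <= dot u x).
Proof.
move=> x hx; rewrite leNgt; apply/negP => ux.
have N0 := enorm_ge0 u.
have N1 : 0 < enorm u + 1 by lra.
(* Within this distance Cauchy-Schwarz keeps [dot u y] negative; the [+ 1] keeps the denominator
   positive. *)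
have [|y [uy yx]] := hx (- dot u x / (enorm u + 1)).
  by rewrite divr_gt0// oppr_gt0.
have := dot_le_enorm u (y - x); rewrite dotDr dotNr.
have : enorm u * enorm (y - x) <= enorm u * (- dot u x / (enorm u + 1)).
  by rewrite ler_wpM2l// ltW.
set q := _ / _.
have q0 : 0 < q by rewrite divr_gt0// oppr_gt0.
have : q * (enorm u + 1) = - dot u x by rewrite divfK ?gt_eqF.
lra.
Qed.

(* The points of E with 0 <= dot u x are at distance at least some s > r from the origin,
   and the others move away from the center: a ball shifted by t u, t |u| <= s - r, misses E. *)
Lemma hulloid_contact_direction E a u : 0 < r -> is_closed E ->
  (forall x, E x -> r <= enorm x) -> hulloid r E a -> enorm a = r ->
  (forall x, E x -> enorm x = r -> dot u x < 0) -> dot u a <= 0.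
Proof.
move=> r0 cE Er ha ar hu; rewrite leNgt; apply/negP => ua.
pose A x := E x /\ 0 <= dot u x.
(* [s] is the least norm on the closed set [A], attained at a point that [hu] prevents from having
   norm [r]; [r + 1] serves when [A] is empty. *)
have [s rs As] : exists2 s, r < s & forall x, A x -> s <= enorm x.
  have [A0|A0] := pselect (exists x, A x); last first.
    by exists (r + 1); [rewrite ltrDl | move=> x Ax; case: A0; exists x].
  have [|y [Ey uy] ymin] := closed_closest_point 0 _ A0.
    move=> x hx; split; [apply: cE|apply: halfspace_closed] => e /hx[y [[Ey uy] yx]];
    by exists y.
  exists (enorm y); last by move=> x /ymin; rewrite !subr0.
  rewrite lt_neqAle Er// andbT; apply/eqP => /esym/(hu _ Ey).
  by rewrite ltNge uy.
have N0 := enorm_ge0 u; set N := enorm u in N0.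
(* The first bound keeps the shifted ball away from [A]; the second gives
   [t * N ^+ 2 < 2 * dot u a], which puts [a] inside it. *)
pose t := Num.min ((s - r) / (N + 1)) (dot u a / (N ^+ 2 + 1)).
have N1 : 0 < N + 1 by lra.
have N2 : 0 < N ^+ 2 + 1 by have := sqr_ge0 N; lra.
have t0 : 0 < t by rewrite lt_min !divr_gt0// subr_gt0.
have tN : t * N <= s - r.
  have : t * (N + 1) <= s - r by rewrite -ler_pdivlMr// ge_min lexx.
  by rewrite mulrDr mulr1; lra.
have tN2 : t * N ^+ 2 < 2 * dot u a.
  have : t * (N ^+ 2 + 1) <= dot u a by rewrite -ler_pdivlMr// ge_min lexx orbT.
  by rewrite mulrDr mulr1; lra.
have sqE x : dot (x - t *: u) (x - t *: u) =
    dot x x - t * (2 * dot u x - t * N ^+ 2).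
  by rewrite /N enorm_sqr !dotE (dotC x u); ring.
apply: (ha (t *: u)).
  move=> x Ex xu.
  (* The shift brings [x] from distance at least [r] to less than [r] from the center, which forces
     [dot u x] to be positive. *)
  have ux : 0 <= dot u x.
    move: xu. rewrite /oball enorm_lt ?(ltW r0)//. rewrite sqE -enorm_sqr => h.
    have h1 : r ^+ 2 <= enorm x ^+ 2 by rewrite ler_pXn2r ?nnegrE ?(ltW r0) ?enorm_ge0 ?Er.
    have : 0 < t * (2 * dot u x - t * N ^+ 2) by lra.
    rewrite pmulr_rgt0// => h2.
    have : 0 <= t * N ^+ 2 by rewrite mulr_ge0 ?sqr_ge0// ltW.
    lra.
  have := As _ (conj Ex ux); apply/negP; rewrite -ltNge.
  rewrite -{1}(subrK (t *: u) x) (le_lt_trans (enormD _ _))//.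
  rewrite enormZ gtr0_norm//; move: xu; rewrite /oball -/N; lra.
rewrite /oball enorm_lt ?(ltW r0)// sqE -enorm_sqr ar gtrBl mulr_gt0//; lra.
Qed.

(** * Points of [E] on a supporting sphere centered at the origin *)

Section Contact.
Variables (E : 'rV[R]_d -> Prop) (a : 'rV[R]_d).
Hypotheses (r0 : 0 < r) (cE : is_closed E) (Er : forall x, E x -> r <= enorm x).
Hypotheses (ha : hulloid r E a) (ar : enorm a = r) (nEa : ~ E a).

(** Plain membership in [E] replaces membership in its boundary: as [E] avoids the open ball,
    [boundary_of_sphere] makes the two agree on the sphere. *)
Let contact x := E x /\ enorm x = r.

Lemma contact_compact : compact contact.
Proof.
apply: (@closed_bounded_compact _ _ _ r) => [x hx|x [_ ->]//].
split; first by apply: cE => e /hx[y [[Ey _] yx]]; exists y.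
apply/eqP; rewrite eq_le; apply/andP; split; apply/ler_addgt0Pr => e /hx[y [[_ <-] yx]].
  have := enorm_dist_triangle y x 0; rewrite !subr0 (enormB x); lra.
by have := enorm_dist_triangle x y 0; rewrite !subr0; lra.
Qed.

Lemma exists_two_contacts : exists x1 x2, contact x1 /\ contact x2 /\ x1 <> x2.
Proof.
have [x0 K0] : exists x, contact x.
  apply: contrapT => noK.
  have : dot a a <= 0.
    apply: (hulloid_contact_direction (E := E)) => // x Ex xr.
    by case: noK; exists x.
  by apply/negP; rewrite -ltNge -enorm_sqr ar exprn_gt0.
apply: contrapT => noK.
have ax : 0 < dot (a - x0) (a - x0).
  rewrite lt_neqAle dot_ge0 andbT eq_sym; apply/eqP => /dot_eq0/eqP.
  by rewrite subr_eq0 => /eqP ax; apply: nEa; rewrite ax; exact: K0.1.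
have aa : dot a a = r ^+ 2 by rewrite -enorm_sqr ar.
have xx : dot x0 x0 = r ^+ 2 by rewrite -enorm_sqr K0.2.
move: ax; rewrite !dotE (dotC x0 a) aa xx => ax.
(* Since [a] and [x0] are distinct of norm [r], [dot a x0 < r ^+ 2]; so [a - x0] has negative
   product with [x0] and positive product with [a]. *)
have : dot (a - x0) a <= 0.
  apply: (hulloid_contact_direction (E := E)) => // x Ex xr.
  have [->|xx0] := pselect (x = x0); first by rewrite !dotE xx; lra.
  by case: noK; exists x, x0.
by rewrite !dotE (dotC x0 a) aa; lra.
Qed.

Lemma contact_cone_sum : pointed (conv (cone0 contact)) ->
  exists (n : nat) (Q : {set 'I_n}) (p : 'I_n -> 'rV[R]_d) (w : 'I_n -> R),
    [/\ forall i, i \in Q -> contact (p i), forall i, 0 <= w i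
      & a = \sum_(i in Q) w i *: p i].
Proof.
move=> ptd.
have K0 : ~ contact 0 by move=> [_]; rewrite enorm0 => r00; have := r0; rewrite -r00 ltxx.
have [n [p [w [Kp [w0 [sw /esym sp]]]]]] : conv (fun x => contact x \/ x = - a) 0.
  apply: contrapT => /compact_gordan[|u hu].
    by apply: compactU contact_compact _; exact: (@compact_set1 _ (- a)).
  have := hu (- a) (or_intror erefl); rewrite dotNr oppr_lt0; apply/negP.
  rewrite -leNgt; apply: (hulloid_contact_direction (E := E)) => // x Ex xr.
  by apply: hu; left.
pose Q := [set i | `[< contact (p i) >]]%SET.
have KQ i : i \in Q -> contact (p i) by rewrite finset.inE => /asboolP.
(* Every index outside [Q] carries the point [- a], so [T] is the total weight to be moved to the
   other side. *)
pose T := \sum_(i | i \notin Q) w i.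
have sQ : \sum_(i in Q) w i *: p i = T *: a.
  move/eqP: sp; rewrite (bigID (mem Q))/= addr_eq0 => /eqP ->.
  rewrite -sumrN scaler_suml; apply: eq_bigr => i iQ.
  case: (Kp i) => [Ki|->]; last by rewrite scalerN opprK.
  by move: iQ; rewrite finset.inE => /asboolP.
(* If [T] were 0, pointedness would annihilate all weights on [Q], against their total being 1. *)
have T0 : 0 < T.
  rewrite lt_neqAle eq_sym sumr_ge0// andbT; apply/eqP => T0.
  move: sQ; rewrite T0 scale0r => /(pointed_cone0_sum_eq0 ptd K0 KQ) w00.
  move: sw; rewrite (bigID (mem Q))/= -/T T0 addr0 big1 => [|i iQ]; last exact: w00.
  by move/eqP; rewrite eq_sym oner_eq0.
exists n, Q, p, (fun i => T^-1 * w i); split => // [i|].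
  by rewrite mulr_ge0// invr_ge0 ltW.
under eq_bigr do rewrite -scalerA.
by rewrite -scaler_sumr sQ scalerA mulVf ?scale1r// gt_eqF.
Qed.

(** Reducing the conic sum for [a] to independent points gives at once their distinctness and the
    bound [d] on their number. *)
Lemma contact_sph_hull : pointed (conv (cone0 contact)) ->
  exists (s : nat) (x : 'I_s -> 'rV[R]_d),
    (2 <= s <= d)%N /\ injective x /\ (forall i, contact (x i)) /\
    sph_hull r (fun y => exists i, y = x i) a.
Proof.
move=> /contact_cone_sum[n [Q' [p [w [KQ' w0 aE']]]]].
have [Q [v [QQ' indQ v0 vE]]] := conic_caratheodory p Q' w0.
have aE := etrans aE' vE.
have KQ i : i \in Q -> contact (p i) by move=> /(fintype.subsetP QQ'); exact: KQ'.
(* An empty sum would give [a = 0]; a single ray meets the sphere only once, so one point would have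
   to be [a] itself, which is not in [E]. *)
have Q2 : (2 <= #|Q|)%N.
  rewrite ltnNge leq_eqVlt ltnS leqn0 cards_eq0; apply/negP.
  move=> /orP[/cards1P[i Qi]|/eqP Q0]; last first.
    by have := r0; rewrite -ar aE Q0 big_set0 enorm0 ltxx.
  have [Ep pr] : contact (p i) by apply: KQ; rewrite Qi finset.set11.
  apply: nEa; have := ar; rewrite aE Qi big_set1 enormZ pr ger0_norm// => vr.
  by rewrite (_ : v i = 1) ?scale1r//; apply: (@mulIf _ r); rewrite ?mul1r// gt_eqF.
exists #|Q|, (fun k => p (enum_val k)); rewrite Q2 (independent_on_card indQ).
split => //; split; [|split; [|split]].
- move=> k l /(independent_on_inj indQ) kl; apply: enum_val_inj.
  by apply: kl; exact: enum_valP.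
- by move=> k; apply/KQ/enum_valP.
- rewrite aE big_enum_val.
  have -> : \sum_(k < #|Q|) v (enum_val k) *: p (enum_val k) =
    \sum_(k in [set: 'I_#|Q|]%SET) v (enum_val k) *: p (enum_val k).
    by apply: eq_bigl => k; rewrite finset.in_setT.
  apply: cone0_conv_sum => //; last by move=> k _; exists k.
  by rewrite -card_gt0 cardsT card_ord; exact: ltnW.
- by rewrite /sphere subr0.
Qed.

End Contact.
End Hulloid.

Theorem mainTheorem4 (R : realType) (d : nat) (r : R) (E : 'rV[R]_d -> Prop)
    (a : 'rV[R]_d) :
  0 < r -> body E -> boundary (hulloid r E) a -> ~ E a ->
  (exists c : 'rV[R]_d, supports r c (hulloid r E) a) /\
  (forall c : 'rV[R]_d, supports r c (hulloid r E) a ->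
     (* after translating by -c: ball centered at o, S = sphere 0 r *)
     let E' := translate c E in
     let a' := a - c in
     let bES := fun x => boundary E' x /\ sphere 0 r x in
     (* (i) *)
     (exists x1 x2, bES x1 /\ bES x2 /\ x1 <> x2) /\
     (* (ii) *)
     (pointed (conv (cone0 bES)) ->
        exists (s : nat) (x : 'I_s -> 'rV[R]_d),
          (2 <= s <= d)%N /\ injective x /\ (forall i, bES (x i)) /\
          sph_hull r (fun y => exists i, y = x i) a')).
Proof.
move=> r0 [_ cE] bE nEa; split; first exact: exists_supports.
move=> c [ac hc] E' a' bES.
have cE' : is_closed E' by exact: translate_closed.
(* The supporting ball misses the hulloid, which contains [E]. *)
have Er x : E' x -> r <= enorm x.
  move=> Ex; rewrite leNgt; apply/negP => xr.
  by apply: (hc (x + c) (@sub_hulloid _ _ r E _ Ex)); rewrite /oball addrK.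
have ha : hulloid r E' a' by apply: hulloid_translate; exact: boundary_hulloid.
have nEa' : ~ E' a' by rewrite /E' /translate subrK.
have -> : bES = fun x => E' x /\ enorm x = r.
  apply/funext => x; apply/propext; rewrite /bES /sphere subr0; split => -[].
    by move=> /(boundary_closed cE').
  by move=> Ex xr; split => //; exact: boundary_of_sphere Er Ex xr.
split; first exact: (exists_two_contacts r0 cE' Er ha ac nEa').
exact: (contact_sph_hull r0 cE' Er ha ac nEa').
Qed.
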